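(* Let $(\Omega,\mathcal{F},\mathbb{P})$ be a complete probability space, let $(\mathcal{H},\langle\cdot,\cdot\rangle,\|\cdot\|)$ be a separable real Hilbert space, and let $X:\Omega\to\mathcal{H}$ be an $\mathcal{H}$-valued random variable with distribution $X_{\sharp}\mathbb{P}$ such that $$\int_{\mathcal{H}}\|v\|\,d(X_{\sharp}\mathbb{P})(v)<\infty .$$ Then there exists a unique vector $\mu\in\mathcal{H}$ such that $$\int_{\mathcal{H}}\langle u,v\rangle\,d(X_{\sharp}\mathbb{P})(v)=\langle u,\mu\rangle\qquad\text{for all }u\in\mathcal{H}.$$
   Context: $\mathcal{B}(\mathcal{H})$ denotes the Borel $\sigma$-algebra of $\mathcal{H}$ (generated by the norm-open sets). An $\mathcal{H}$-valued random variable is a map $X:\Omega\to\mathcal{H}$ with $X^{-1}(\mathcal{O})\in\mathcal{F}$ for every open $\mathcal{O}\subset\mathcal{H}$. Its distribution is the pushforward probability measure $X_{\sharp}\mathbb{P}$ on $(\mathcal{H},\mathcal{B}(\mathcal{H}))$ given by $X_{\sharp}\mathbb{P}(B)=\mathbb{P}(X^{-1}(B))$ for $B\in\mathcal{B}(\mathcal{H})$. The vector $\mu$ is called the expectation (Bochner integral) of $X$ and is denoted $\mathbb{E}(X)$. *)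

(* Defs.v *)
From HB Require Import structures.
From mathcomp Require Import all_boot all_order all_algebra.
From mathcomp Require Import all_classical all_reals all_analysis.

Set Implicit Arguments.
Unset Strict Implicit.
Unset Printing Implicit Defensive.

Import Order.TTheory GRing.Theory Num.Theory.
Import numFieldNormedType.Exports.

Local Open Scope classical_set_scope.
Local Open Scope ring_scope.

Definition separable (T : topologicalType) : Prop :=
  exists2 D : set T, countable D & dense D.

(* A type synonym of T, so that points of T are points of borelType T. *)
Notation borelType T := (g_sigma_algebraType (@open T)).

Definition is_random_variable (d : measure_display) (Omega : measurableType d)
    (T : ptopologicalType) (X : Omega -> T) : Prop :=
  forall O : set T, open O -> measurable (X @^-1` O).

Lemma is_random_variable_measurable (d : measure_display)
    (Omega : measurableType d) (T : ptopologicalType) (X : Omega -> T) :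
  is_random_variable X ->
  measurable_fun [set: Omega] (X : Omega -> borelType T).
Proof.
move=> rvX; apply: (@measurability _ _ _ (borelType T) _ _ (@open T)) => //.
by move=> _ [U openU <-]; rewrite setTI; exact: rvX.
Qed.

Definition random_variable_mfun (d : measure_display)
    (Omega : measurableType d) (T : ptopologicalType) (X : Omega -> T)
    (rvX : is_random_variable X) : {mfun Omega >-> borelType T} :=
  HB.pack (X : Omega -> borelType T)
    (isMeasurableFun.Build _ _ _ _ _ (is_random_variable_measurable rvX)).

(* By conversion, law P rvX B is P (X @^-1` B). *)
Definition law (d : measure_display) (Omega : measurableType d) (R : realType)
    (P : probability Omega R) (T : ptopologicalType) (X : Omega -> T)
    (rvX : is_random_variable X) : probability (borelType T) R :=
  distribution P (random_variable_mfun rvX).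

(* Main.v *)
(* The functional u |-> E<u, X> is linear and, by Cauchy-Schwarz, bounded by
   E|X|, so it is represented by a vector.  The representing vector of a bounded
   linear functional L is obtained as the limit of a minimizing sequence of the
   energy J u = <u, u> - 2 L u: being e^2-close to the infimum of J forces
   |<u, w> - L w| <= e |w| for every w, which gives at once that such a sequence
   is Cauchy and that its limit represents L. *)
Require Import Defs.
From HB Require Import structures.
From mathcomp Require Import all_boot all_order all_algebra.
From mathcomp Require Import all_classical all_reals all_analysis.
From mathcomp Require Import measurable_realfun ring lra.

Set Implicit Arguments.
Unset Strict Implicit.
Unset Printing Implicit Defensive.

Import Order.TTheory GRing.Theory Num.Theory.
Import numFieldNormedType.Exports.

Local Open Scope classical_set_scope.
Local Open Scope ring_scope.

Section RealInnerProduct.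
Variables (R : realType) (H : normedModType R) (ip : {dot H for idfun}).
Hypothesis norm_ip : forall v : H, `|v| = Num.sqrt (ip v v).

Lemma ip_sym u v : ip u v = ip v u.
Proof. by have := hermC ip u v; rewrite expr0 mul1r. Qed.

Let ipDl u v w : ip (u + v) w = ip u w + ip v w.
Proof. exact: linearDl. Qed.

Let ipZl a u w : ip (a *: u) w = a * ip u w.
Proof. exact: linearZl_LR. Qed.

Lemma ipBl u v w : ip (u - v) w = ip u w - ip v w.
Proof. exact: linearBl. Qed.

Lemma ipBr u v w : ip w (u - v) = ip w u - ip w v.
Proof. by rewrite ip_sym ipBl !(ip_sym w). Qed.

Lemma ip_eq0 v : (ip v v == 0) = (v == 0).
Proof.
have [->|v0] := eqVneq v 0; first by rewrite -(scale0r 0) ipZl mul0r eqxx.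
by rewrite gt_eqF// neq0_dnorm_gt0.
Qed.

Lemma ip_ge0 v : 0 <= ip v v.
Proof.
have [->|v0] := eqVneq v 0; first by rewrite le_eqVlt eq_sym ip_eq0 eqxx.
exact/ltW/neq0_dnorm_gt0.
Qed.

Lemma ip_normE v : ip v v = `|v| ^+ 2.
Proof. by rewrite norm_ip sqr_sqrtr// ip_ge0. Qed.

Lemma ip_addZ_sqr t u w :
  ip (u + t *: w) (u + t *: w) = ip u u + 2 * t * ip u w + t ^+ 2 * ip w w.
Proof.
rewrite ipDl ipZl (ip_sym u) (ip_sym w) !ipDl !ipZl (ip_sym w u); ring.
Qed.

Lemma ip_cauchy_schwarz u w : `|ip u w| <= `|u| * `|w|.
Proof.
rewrite -(@ler_sqr _ `|_|) ?nnegrE ?mulr_ge0// real_normK ?num_real//.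
rewrite exprMn -!ip_normE.
have [->|w0] := eqVneq w 0.
  by rewrite !(ip_sym u) -(scale0r 0) !ipZl !mul0r expr0n mulr0.
have ww0 : 0 < ip w w by rewrite neq0_dnorm_gt0.
(* This vector is the component of [u] orthogonal to [w]; its squared norm times [ip w w] is
   [ip u u * ip w w - ip u w ^+ 2]. *)
have := ip_ge0 (u + (- (ip u w / ip w w)) *: w).
rewrite ip_addZ_sqr -subr_ge0 -(@pmulr_rge0 _ (ip w w))//.
by congr (_ <= _); field; rewrite gt_eqF.
Qed.

Lemma ip_continuous u : continuous (ip u).
Proof.
move=> v; apply/cvgrPdist_lt => e e0.
(* Adding 1 keeps the divisor positive when [u] is zero. *)
have k0 : 0 < `|u| + 1 by rewrite ltr_wpDl.
have : \forall w \near v, `|v - w| < e / (`|u| + 1).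
  by apply: cvgr_dist_lt; rewrite ?divr_gt0.
apply: filterS => w vw; rewrite -ipBr (le_lt_trans (ip_cauchy_schwarz _ _))//.
rewrite (@le_lt_trans _ _ ((`|u| + 1) * `|v - w|))//.
  by rewrite ler_wpM2r// lerDl.
by rewrite mulrC -ltr_pdivlMr.
Qed.

End RealInnerProduct.

Section Riesz.
Variables (R : realType) (H : completeNormedModType R) (ip : {dot H for idfun}).
Hypothesis norm_ip : forall v : H, `|v| = Num.sqrt (ip v v).
Variables (L : H -> R) (C : R).
Hypothesis LD : forall u v, L (u + v) = L u + L v.
Hypothesis LZ : forall a u, L (a *: u) = a * L u.
Hypothesis L_bounded : forall u, L u <= C * `|u|.

Let J u := ip u u - 2 * L u.

Let has_inf_J : has_inf (range J).
Proof.
split; first by exists (J 0), 0.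
(* Completing the square: [J u] is at least [|u|^2 - 2 C |u| = (|u| - C)^2 - C^2]. *)
exists (- C ^+ 2) => _ [u _ <-]; rewrite /J ip_normE//.
by have := L_bounded u; have := sqr_ge0 (`|u| - C); nra.
Qed.

Let m := inf (range J).

(** Up to a factor 2, [ip u w - L w] is the derivative of [J] at [u] along [w]. A large slope would
    let a move along [w] lower [J] by more than [e ^+ 2], hence below its infimum. *)
Lemma almost_minimizer_gradient e u w : 0 <= e -> J u < m + e ^+ 2 ->
  `|ip u w - L w| <= e * `|w|.
Proof.
move=> e0 Ju; rewrite -(@ler_sqr _ `|_|) ?nnegrE ?mulr_ge0//.
rewrite real_normK ?num_real// exprMn -(ip_normE norm_ip).
have [->|w0] := eqVneq w 0.
  have L0 : L 0 = 0 by rewrite -(scale0r 0) LZ mul0r.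
  have ip0 x : ip x 0 = 0 by rewrite -(subrr 0) ipBr subrr.
  by rewrite L0 !ip0 subrr expr0n mulr0.
have ww0 : 0 < ip w w by rewrite neq0_dnorm_gt0.
(* The minimizer of the quadratic polynomial [s |-> J (u + s *: w)]. *)
pose t := - ((ip u w - L w) / ip w w).
have mJ : m <= J (u + t *: w).
  by apply: ge_inf; [exact: has_inf_J.2 | exists (u + t *: w)].
have : J (u + t *: w) = J u - (ip u w - L w) ^+ 2 / ip w w.
  by rewrite /J LD LZ ip_addZ_sqr /t; field; rewrite gt_eqF.
by rewrite -ler_pdivrMr//; lra.
Qed.

Lemma riesz_representation : exists mu, forall u, L u = ip u mu.
Proof.
pose e n : R := n.+1%:R^-1.
have e_gt0 n : 0 < e n by rewrite invr_gt0.
have /choice[x xP] n : exists x, J x < m + e n ^+ 2.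
  have [_ [x _ <-] Jx] := inf_adherent (exprn_gt0 2 (e_gt0 n)) has_inf_J.
  by exists x.
have grad n w : `|ip (x n) w - L w| <= e n * `|w|.
  by apply: almost_minimizer_gradient => //; exact: ltW.
(* Test both gradient bounds on [w = x p - x q]: the terms [L w] cancel in
   [ip (x p) w - ip (x q) w = |w|^2], and one factor [|w|] is divided out. *)
have dist p q : `|x p - x q| <= e p + e q.
  have [->|d0] := eqVneq (x p - x q) 0.
    by rewrite normr0 addr_ge0// ltW.
  have := grad p (x p - x q); have := grad q (x p - x q).
  have := ip_normE norm_ip (x p - x q); rewrite [in LHS]ipBl => dE gq gp.
  have d_gt0 : 0 < `|x p - x q| by rewrite normr_gt0.
  rewrite -(ler_pM2r d_gt0) -expr2 -dE mulrDl.
  move: gp gq; rewrite !ler_norml => /andP[_ gp] /andP[gq _]; lra.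
have e_cvg d : 0 < d -> \forall n \near \oo, e n < d.
  by move=> d0; exact: (near_infty_natSinv_lt (PosNum d0)).
have /cauchy_cvg/cvg_ex[mu xmu] : cauchy (x @ \oo).
  apply/cauchy_ballP => d d0.
  have ed := e_cvg _ (divr_gt0 d0 (ltr0Sn R 1)).
  exists ([set y | exists2 n, e n < d / 2 & y = x n],
          [set y | exists2 n, e n < d / 2 & y = x n]) => /=.
    by split; apply: filterS ed => n en; exists n.
  move=> [_ _] [[p ep ->] [q eq ->]]; rewrite -ball_normE/=.
  by rewrite (le_lt_trans (dist _ _))// (splitr d) ltrD.
exists mu => u.
have ipmu : ip u (x n) @[n --> \oo] --> ip u mu.
  by apply: (cvg_comp x (ip u) xmu); exact: ip_continuous.
(* The gradient bounds make the same sequence [ip u (x n)] tend to [L u] as well. *)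
apply: (@cvg_unique _ _ (ip u \o x @ \oo)) => //.
apply/cvgrPdist_lt => d d0.
have k0 : 0 < `|u| + 1 by rewrite ltr_wpDl.
apply: filterS (e_cvg _ (divr_gt0 d0 k0)) => n; rewrite ltr_pdivlMr// => en /=.
rewrite distrC ip_sym (le_lt_trans (grad n u))// (le_lt_trans _ en)//.
by rewrite ler_wpM2l ?lerDl// ltW.
Qed.

End Riesz.

(** Open rays generate the Borel sets of [R], and their preimages are open, hence among the
    generators of [borelType T]. *)
Lemma continuous_borel_measurable (R : realType) (T : ptopologicalType)
  (f : T -> R) : continuous f ->
  measurable_fun [set: borelType T] (f : borelType T -> R).
Proof.
move=> /continuousP cf.
apply: (measurability _ (RGenOInfty.measurableE R)) => _ [_ [a ->] <-].
by rewrite setTI; apply: sub_sigma_algebra; apply: cf; exact: interval_open.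
Qed.

Theorem mainTheorem1 (R : realType)
    (d : measure_display) (Omega : measurableType d) (P : probability Omega R)
    (complete_P : measure_is_complete P)
    (H : completeNormedModType R) (ip : {dot H for idfun})
    (norm_ip : forall v : H, `|v| = Num.sqrt (ip v v))
    (separable_H : separable H)
    (X : Omega -> H) (rvX : is_random_variable X)
    (first_moment : (\int[law P rvX]_v `|v : H|%:E < +oo)%E) :
  exists! mu : H, forall u : H,
    (\int[law P rvX]_v (ip u v)%:E = (ip u mu)%:E)%E.
Proof.
set Q := law P rvX.
have int_norm : Q.-integrable setT (fun v => `|v : H|%:E).
  apply/integrableP; split.
    apply/measurable_EFinP; apply: continuous_borel_measurable.
    exact: norm_continuous.
  by under eq_integral do rewrite /= normr_id.
have int_ip u : Q.-integrable setT (fun v => (ip u v)%:E).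
  (* By Cauchy-Schwarz, [|u| * |v|] is an integrable dominating function. *)
  apply: (le_integrable measurableT _ _ (integrableZl measurableT `|u| int_norm)).
  - apply/measurable_EFinP; apply: continuous_borel_measurable.
    exact: ip_continuous.
  - move=> v _; rewrite /= lee_fin normrM !normr_id.
    exact: ip_cauchy_schwarz.
(* The real-valued integral sends infinite values to 0; integrability rules them out, so [L] agrees
   with the extended integral. *)
pose L u : R := (\int[Q]_v ip u v)%R.
have LE u : (\int[Q]_v (ip u v)%:E)%E = (L u)%:E.
  by rewrite fineK//; exact: integrable_fin_num.
have [|||mu muP] := @riesz_representation R H ip norm_ip L (\int[Q]_v `|v : H|)%R.
- move=> u v; rewrite /L -(RintegralD _ (int_ip u) (int_ip v))//.
  congr (Rintegral _ _ _); apply/funext => w.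
  exact: linearDl.
- move=> a u; rewrite /L -(RintegralZl _ _ (int_ip u))//.
  congr (Rintegral _ _ _); apply/funext => w.
  exact: linearZl_LR.
- move=> u; rewrite mulrC -(RintegralZl _ _ int_norm)//; apply: le_Rintegral => //.
  - exact: int_ip.
  - exact: (integrableZl measurableT `|u| int_norm).
  - by move=> v _; rewrite (le_trans (ler_norm _))// ip_cauchy_schwarz.
exists mu; split=> [u|nu nuP]; first by rewrite LE muP.
(* Uniqueness: testing both representations on [u = mu - nu] gives [ip (mu - nu) (mu - nu) = 0]. *)
apply/eqP; rewrite -subr_eq0 -(ip_eq0 ip) ipBr subr_eq0; apply/eqP.
by rewrite -muP; apply: EFin_inj; rewrite -LE nuP.
Qed.
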